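(* Let $m\ge 2$, $n\ge 1$, let $\mathcal{B}$ be a nonnegative irreducible tensor of order $m$ and dimension $n$, and let $\mathcal{A}=\mathcal{B}+\mathcal{I}$. Define $\mathcal{A}^{(0)}=\mathcal{A}$ and, for $k=0,1,2,\dots$, with $\mathcal{A}^{(k)}=(a^{(k)}_{i_1i_2\cdots i_m})$, $$R^{(k)}_i=\sum_{i_2,\dots,i_m=1}^n a^{(k)}_{i i_2\cdots i_m}\quad(1\le i\le n),\qquad R^{(k)}=\max_{1\le i\le n}R^{(k)}_i,\qquad r^{(k)}=\min_{1\le i\le n}R^{(k)}_i,$$ $$a^{(k+1)}_{i i_2\cdots i_m}=(R^{(k)}_i)^{-1}\,a^{(k)}_{i i_2\cdots i_m}\,(R^{(k)}_{i_2})^{\frac1{m-1}}\cdots (R^{(k)}_{i_m})^{\frac1{m-1}}\qquad (1\le i,i_2,\dots,i_m\le n).$$ Then $$\lim_{k\to\infty} r^{(k)}=\lim_{k\to\infty}R^{(k)}=\rho(\mathcal{A}).$$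
   Context: A real tensor of order $m$ and dimension $n$ is an array $\mathcal{A}=(a_{i_1\cdots i_m})$ of $n^m$ real entries, $1\le i_1,\dots,i_m\le n$; it is nonnegative if all entries are $\ge 0$. $\mathcal{I}$ is the identity tensor, with entry $1$ if $i_1=i_2=\cdots=i_m$ and $0$ otherwise. Irreducibility: a tensor $\mathcal{C}=(c_{i_1\cdots i_m})$ is reducible if there is a nonempty proper subset $I\subset\{1,\dots,n\}$ with $c_{i_1\cdots i_m}=0$ for all $i_1\in I$ and all $i_2,\dots,i_m\notin I$; otherwise it is irreducible. Eigenvalues: for a vector $x$, $(\mathcal{A}x^{m-1})_i=\sum_{i_2,\dots,i_m=1}^n a_{i i_2\cdots i_m}x_{i_2}\cdots x_{i_m}$ and $(x^{[m-1]})_i=x_i^{m-1}$. A number $\lambda\in\mathbb{C}$ is an eigenvalue of $\mathcal{A}$ with eigenvector $x\in\mathbb{C}^n\setminus\{0\}$ if $\mathcal{A}x^{m-1}=\lambda x^{[m-1]}$. The spectral radius is $\rho(\mathcal{A})=\max\{|\lambda| : \lambda \text{ is an eigenvalue of }\mathcal{A}\}$. The sequences are those generated by the paper's algorithm without its stopping test $R^{(k)}=r^{(k)}$; all $R^{(k)}_i$ are positive, so they are well defined. *)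

(* Defs.v *)
From HB Require Import structures.
From mathcomp Require Import all_boot all_order all_algebra.
From mathcomp Require Import complex.
From mathcomp Require Import all_classical all_reals all_analysis.

Set Implicit Arguments.
Unset Strict Implicit.
Unset Printing Implicit Defensive.

Import Order.TTheory GRing.Theory Num.Theory.
Import numFieldNormedType.Exports.

Local Open Scope classical_set_scope.
Local Open Scope ring_scope.
Local Open Scope complex_scope.

(* Meaningful for m >= 1: the entry a_{i_1 i_2 ... i_m} is [A i t], where
   [i] stands for i_1 and the tuple [t] for (i_2, ..., i_m). *)
Definition tensor (K : Type) (m n : nat) := 'I_n -> m.-1.-tuple 'I_n -> K.

Section AlgebraicNotions.
Variables (K : nzRingType) (m n : nat).
Implicit Types (A B : tensor K m n) (x : 'cV[K]_n).

Definition tensor_id : tensor K m n := fun i t => (all (pred1 i) t)%:R.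

Definition tensor_add A B : tensor K m n := fun i t => A i t + B i t.

Definition tensor_reducible A : Prop :=
  exists I : {set 'I_n}, [/\ I != finset.set0, I != [set: 'I_n]%SET &
    forall (i : 'I_n) (t : m.-1.-tuple 'I_n),
      i \in I -> (forall j, j \in t -> j \notin I) -> A i t = 0].

Definition tensor_irreducible A : Prop := ~ tensor_reducible A.

Definition tensor_apply A x : 'cV[K]_n :=
  \col_i \sum_(t : m.-1.-tuple 'I_n) A i t * \prod_(j <- t) x j 0.

Definition tensor_rowsum A (i : 'I_n) : K :=
  \sum_(t : m.-1.-tuple 'I_n) A i t.

End AlgebraicNotions.

Definition vec_power (K : nzRingType) (n p : nat) (x : 'cV[K]_n) : 'cV[K]_n :=
  \col_i x i 0 ^+ p.

Definition tensor_nonneg (R : realType) (m n : nat) (A : tensor R m n) : Prop :=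
  forall i t, 0 <= A i t.

Definition tensor_complex (R : realType) (m n : nat) (A : tensor R m n) :
  tensor R[i] m n := fun i t => (A i t)%:C.

Definition tensor_eigenvalue (R : realType) (m n : nat) (A : tensor R m n)
    (lambda : R[i]) : Prop :=
  exists x : 'cV[R[i]]_n, x != 0 /\
    tensor_apply (tensor_complex A) x = lambda *: vec_power m.-1 x.

(* [rho] is the maximum (attained) of the moduli of the eigenvalues. The modulus
   [`|lambda|] lives in R[i], whose order compares only numbers with equal
   imaginary parts; both sides below are real. *)
Definition is_spectral_radius (R : realType) (m n : nat) (A : tensor R m n)
    (rho : R) : Prop :=
  (exists2 lambda, tensor_eigenvalue A lambda & `|lambda| = rho%:C) /\
  (forall lambda, tensor_eigenvalue A lambda -> `|lambda| <= rho%:C).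

Definition tensor_rescale (R : realType) (m n : nat) (A : tensor R m n) :
    tensor R m n :=
  fun i t => (tensor_rowsum A i)^-1 * A i t *
    \prod_(j <- t) (tensor_rowsum A j `^ (m.-1%:R^-1)).

Definition tensor_iter (R : realType) (m n : nat) (A : tensor R m n) (k : nat) :
    tensor R m n :=
  iter k (@tensor_rescale R m n) A.

(* The default value of each big operator is itself one of the row sums, so
   these are the maximum and the minimum over the indices. *)
Definition max_rowsum (R : realType) (m n : nat) (A : tensor R m n.+1) : R :=
  \big[Num.max/tensor_rowsum A ord0]_(i < n.+1) tensor_rowsum A i.

Definition min_rowsum (R : realType) (m n : nat) (A : tensor R m n.+1) : R :=
  \big[Num.min/tensor_rowsum A ord0]_(i < n.+1) tensor_rowsum A i.

(* Main.v *)
Require Import Defs.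
From HB Require Import structures.
From mathcomp Require Import all_boot all_order all_algebra.
From mathcomp Require Import complex.
From mathcomp Require Import all_classical all_reals all_analysis.
From mathcomp Require Import ring.

Import Order.TTheory GRing.Theory Num.Theory.
Import numFieldNormedType.Exports.

Local Open Scope classical_set_scope.
Local Open Scope ring_scope.

(** Conjugating a tensor by a positive diagonal telescopes: the [k]-th rescaled
    tensor is [A] conjugated by the vector [x_k] of a power iteration
    [x_{k+1}^[m-1] = A x_k^{m-1}] started at the all-ones vector. Its row sums are
    therefore the Collatz-Wielandt ratios [(A x_k^{m-1})_i / x_{k,i}^{m-1}]
    ([tensor_iterE]). As the iteration map is monotone and homogeneous, the largest
    ratio does not increase and the smallest does not decrease
    ([supersolution_step], [subsolution_step]); call the limits [L] and [l].

    The normalised iterates have a limit orbit [Y_0, Y_1, ...] of the same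
    iteration ([limit_orbit]). It is positive because a nonzero nonnegative vector
    [u] with [A u^{m-1} <= M u^[m-1]] has no zero coordinate when [A] is
    irreducible ([supersolution_gt0]). By continuity every [Y_q] has largest ratio
    [L] and smallest ratio [l]. If some ratio of [Y_0] were below [L], irreducibility
    and the positive diagonal of [A = B + I] would spread the strict inequality to all
    indices within finitely many steps, so that some [Y_q] would have its largest
    ratio below [L] ([persistent_max_ratio]). Hence all the ratios of [Y_0] are [L]:
    then [l = L], and [Y_0] is a positive eigenvector for [L], which forces [L] to be
    the spectral radius ([spectral_radius_pos_eigenvector]). *)

(** * Monotone homogeneous forms *)

(** [A x^{m-1}] for a coordinate function [x]; functions rather than column
    vectors make scaling and limits of [x] pointwise operations. *)
Definition homog_form {K : nzRingType} {m n : nat} (A : tensor K m n)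
    (x : 'I_n -> K) (i : 'I_n) : K :=
  \sum_(t : m.-1.-tuple 'I_n) A i t * \prod_(j <- t) x j.

Lemma prodr_const_tuple (K : nzRingType) (T : Type) (p : nat) (t : p.-tuple T)
    (c : K) :
  \prod_(j <- t) c = c ^+ p.
Proof. by rewrite big_const_seq count_predT size_tuple iter_mulr_1. Qed.

Lemma homog_form_scale (K : comNzRingType) (m n : nat) (A : tensor K m n)
    (x : 'I_n -> K) (c : K) (i : 'I_n) :
  homog_form A (fun j => c * x j) i = c ^+ m.-1 * homog_form A x i.
Proof.
rewrite /homog_form mulr_sumr; apply: eq_bigr => t _.
by rewrite big_split /= prodr_const_tuple mulrCA.
Qed.

Lemma homog_form_ge0 (R : realType) (m n : nat) (A : tensor R m n)
    (x : 'I_n -> R) (i : 'I_n) :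
  tensor_nonneg A -> (forall j, 0 <= x j) -> 0 <= homog_form A x i.
Proof.
by move=> A0 x0; apply: sumr_ge0 => t _; apply: mulr_ge0 => //; apply: prodr_ge0.
Qed.

Lemma homog_form_le (R : realType) (m n : nat) (A : tensor R m n)
    (x y : 'I_n -> R) (i : 'I_n) :
  tensor_nonneg A -> (forall j, 0 <= x j <= y j) ->
  homog_form A x i <= homog_form A y i.
Proof.
move=> A0 xy; apply: ler_sum => t _; apply: ler_wpM2l => //.
by apply: ler_prod.
Qed.

Lemma homog_form_lt (R : realType) (m n : nat) (A : tensor R m n)
    (x y : 'I_n -> R) (i : 'I_n) (t : m.-1.-tuple 'I_n) :
  (2 <= m)%N -> tensor_nonneg A -> (forall j, 0 <= x j <= y j) ->
  A i t != 0 -> (forall j, j \in t -> x j < y j) ->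
  homog_form A x i < homog_form A y i.
Proof.
move=> m2 A0 xy Ait xyt.
rewrite /homog_form (bigD1 t) //= [ltRHS](bigD1 t) //=; apply: ltr_leD; last first.
  by apply: ler_sum => s _; apply: ler_wpM2l => //; apply: ler_prod.
rewrite ltr_pM2l; last by rewrite lt_def Ait A0.
rewrite big_seq [ltRHS]big_seq; apply: ltr_prod.
  have : (0 < size t)%N by rewrite size_tuple; case: (m) m2 => [|[]].
  by case: (tval t) => //= j s _; rewrite inE eqxx.
by move=> j jt; case/andP: (xy j) => -> _; rewrite xyt.
Qed.

Lemma homog_form_gt0 (R : realType) (m n : nat) (A : tensor R m n)
    (x : 'I_n -> R) (i : 'I_n) :
  (2 <= m)%N -> tensor_nonneg A -> 0 < A i (nseq_tuple m.-1 i) ->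
  (forall j, 0 <= x j) -> 0 < x i -> 0 < homog_form A x i.
Proof.
move=> m2 A0 Ai x0 xi.
rewrite /homog_form (bigD1 (nseq_tuple m.-1 i)) //=; apply: ltr_pwDl.
  by apply: mulr_gt0 => //; rewrite big_nseq iter_mulr_1 exprn_gt0.
by apply: sumr_ge0 => t _; apply: mulr_ge0 => //; apply: prodr_ge0.
Qed.

Lemma root_gt0 {R : realType} {p : nat} {M : R} : (0 < p)%N -> 0 < M ->
  exists2 c : R, 0 < c & c ^+ p = M.
Proof.
move=> p0 M0; exists (M `^ p%:R^-1); first exact: powR_gt0.
by rewrite -powR_mulrn ?powR_ge0// -powRrM mulVf ?powRr1 ?ltW // pnatr_eq0 -lt0n.
Qed.

(** With [c ^+ m.-1 = M] the hypothesis reads [y <= c * x]; applying [A], which is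
    monotone and homogeneous of degree [m.-1], gives the same bound one step
    later. *)
Lemma supersolution_step (R : realType) (m n : nat) (A : tensor R m n)
    (x y : 'I_n -> R) (M : R) :
  (2 <= m)%N -> tensor_nonneg A -> 0 < M ->
  (forall i, 0 <= x i) -> (forall i, 0 <= y i) ->
  (forall i, y i ^+ m.-1 = homog_form A x i) ->
  (forall i, homog_form A x i <= M * x i ^+ m.-1) ->
  forall i, homog_form A y i <= M * y i ^+ m.-1.
Proof.
move=> m2 A0 M0 x0 y0 yx xM i.
have p0 : (0 < m.-1)%N by case: (m) m2 => [|[]].
have [c c0 cM] := root_gt0 p0 M0.
rewrite yx -cM -homog_form_scale; apply: homog_form_le => // j; rewrite y0 /=.
by rewrite -(ler_pXn2r p0) ?nnegrE ?mulr_ge0 ?(ltW c0)// exprMn yx cM.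
Qed.

Lemma subsolution_step (R : realType) (m n : nat) (A : tensor R m n)
    (x y : 'I_n -> R) (M : R) :
  (2 <= m)%N -> tensor_nonneg A -> 0 < M ->
  (forall i, 0 <= x i) -> (forall i, 0 <= y i) ->
  (forall i, y i ^+ m.-1 = homog_form A x i) ->
  (forall i, M * x i ^+ m.-1 <= homog_form A x i) ->
  forall i, M * y i ^+ m.-1 <= homog_form A y i.
Proof.
move=> m2 A0 M0 x0 y0 yx xM i.
have p0 : (0 < m.-1)%N by case: (m) m2 => [|[]].
have [c c0 cM] := root_gt0 p0 M0.
rewrite yx -cM -homog_form_scale; apply: homog_form_le => // j.
rewrite mulr_ge0 ?(ltW c0) //=.
by rewrite -(ler_pXn2r p0) ?nnegrE ?mulr_ge0 ?(ltW c0)// exprMn yx cM.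
Qed.

(** * Irreducibility: positivity and spreading of strict inequalities *)

(** If some coordinates of [u] vanished, irreducibility would provide a nonzero
    entry leading from a vanishing coordinate to positive ones only, and the form
    would be positive where the bound [M * u i ^+ m.-1] is zero. *)
Lemma supersolution_gt0 (R : realType) (m n : nat) (A : tensor R m n)
    (u : 'I_n -> R) (M : R) :
  (2 <= m)%N -> tensor_nonneg A -> tensor_irreducible A ->
  (forall i, 0 <= u i) -> (exists i, u i != 0) ->
  (forall i, homog_form A u i <= M * u i ^+ m.-1) ->
  forall i, 0 < u i.
Proof.
move=> m2 A0 Airr u0 [i0 ui0] uM i; rewrite lt_def u0 andbT; apply/negP => ui.
apply: Airr; exists [set j | u j == 0]%SET; split.
- by apply/set0Pn; exists i; rewrite inE.
- by apply/negP => /eqP E; have := finset.in_setT i0; rewrite -E inE (negbTE ui0).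
move=> k t; rewrite inE => /eqP uk tpos.
apply/eqP/negP => /negP Akt.
have := uM k; rewrite uk expr0n (_ : (m.-1 == 0)%N = false) ?mulr0; last first.
  by case: (m) m2 => [|[]].
apply/negP; rewrite -ltNge.
have -> : 0 = homog_form A (fun=> 0) k.
  rewrite /homog_form big1 // => s _.
  rewrite prodr_const_tuple expr0n.
  by case: (m) m2 => [|[]] //= ?; rewrite mulr0.
apply: (@homog_form_lt _ _ _ _ _ _ _ t) => //.
  by move=> j; rewrite lexx u0.
by move=> j /tpos; rewrite inE lt_def u0 andbT.
Qed.

(** The strict set [J q] of indices where the ratio of [Y q] is below [L] grows
    with [q]: an index in [J q] stays because of the positive diagonal entry, and
    as long as [J q] is neither empty nor full, irreducibility provides a nonzero
    entry leading from outside into [J q], whose row becomes strict at the next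
    step. So a nonempty [J 0] would fill all of ['I_n], against the assumption
    that the ratio [L] is attained at every step. *)
Lemma persistent_max_ratio (R : realType) (m n : nat) (A : tensor R m n)
    (Y : nat -> 'I_n -> R) (L : R) :
  (2 <= m)%N -> tensor_nonneg A -> tensor_irreducible A ->
  (forall i, 0 < A i (nseq_tuple m.-1 i)) ->
  (forall q i, 0 < Y q i) ->
  (forall q i, Y q.+1 i ^+ m.-1 = homog_form A (Y q) i) ->
  (forall q i, homog_form A (Y q) i <= L * Y q i ^+ m.-1) ->
  (forall q, exists i, homog_form A (Y q) i = L * Y q i ^+ m.-1) ->
  forall i, homog_form A (Y 0) i = L * Y 0 i ^+ m.-1.
Proof.
move=> m2 A0 Airr Adiag Y0 Yrec YL Yeq.
have p0 : (0 < m.-1)%N by case: (m) m2 => [|[]].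
have Y0' q i : 0 <= Y q i by apply: ltW.
have L0 : 0 < L.
  have [i e] := Yeq 0%N.
  by rewrite -(pmulr_lgt0 _ (exprn_gt0 m.-1 (Y0 0%N i))) -e homog_form_gt0.
have [c c0 cL] := root_gt0 p0 L0.
pose J q := [set i | homog_form A (Y q) i < L * Y q i ^+ m.-1]%SET.
have stepE q i : L * Y q.+1 i ^+ m.-1 = homog_form A (fun j => c * Y q j) i.
  by rewrite homog_form_scale Yrec cL.
have stepW q j : 0 <= Y q.+1 j <= c * Y q j.
  rewrite Y0' -(ler_pXn2r p0) ?nnegrE ?mulr_ge0 ?(ltW c0)// exprMn cL Yrec.
  exact: YL.
have stepS q j : j \in J q -> Y q.+1 j < c * Y q j.
  rewrite inE => jJ.
  by rewrite -(ltr_pXn2r p0) ?nnegrE ?mulr_ge0 ?(ltW c0)// exprMn cL Yrec.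
have grow q i t : A i t != 0 -> {subset t <= J q} -> i \in J q.+1.
  move=> Ait tJ; rewrite inE stepE; apply: (@homog_form_lt _ _ _ _ _ _ _ t) => //.
  by move=> j /tJ /stepS.
have Jsub q : J q \subset J q.+1.
  apply/fintype.subsetP => i iJ; apply: (grow _ _ (nseq_tuple m.-1 i)).
    by rewrite gt_eqF.
  by move=> j; rewrite mem_nseq => /andP[_ /eqP ->].
have Jproper q : J q != finset.set0 -> J q \proper J q.+1.
  move=> Jn0; rewrite properE Jsub /=; apply/negP => Jsup.
  apply: Airr; exists (~: J q)%SET; split.
  - have [i e] := Yeq q; apply/set0Pn; exists i.
    by rewrite !inE e ltxx.
  - by apply: contra Jn0 => /eqP e; rewrite -(finset.setCK (J q)) e finset.setCT.
  move=> i t; rewrite inE => iJ tJ; apply/eqP/negP => /negP Ait.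
  move/negP: iJ; apply; apply: (fintype.subsetP Jsup); apply: (grow _ _ t) => // j /tJ.
  by rewrite inE negbK.
move=> i; apply/eqP; rewrite eq_le YL /= leNgt; apply/negP => iJ0.
have Jcard q : (q < #|J q|)%N.
  elim: q => [|q IH]; first by apply/card_gt0P; exists i; rewrite inE.
  apply: (leq_ltn_trans IH); apply: proper_card; apply: Jproper.
  by rewrite -card_gt0; apply: (leq_ltn_trans (leq0n q)).
by have := leq_trans (Jcard n) (max_card _); rewrite card_ord ltnn.
Qed.

(** * Rescaled tensors as diagonal conjugates *)

Definition power_iterate {R : realType} {m n : nat} (A : tensor R m n) (k : nat) :
    'I_n -> R :=
  iter k (fun x i => homog_form A x i `^ m.-1%:R^-1) (fun=> 1).

Lemma power_iterate_gt0 (R : realType) (m n : nat) (A : tensor R m n)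
    (k : nat) (i : 'I_n) :
  (2 <= m)%N -> tensor_nonneg A -> (forall i, 0 < A i (nseq_tuple m.-1 i)) ->
  0 < power_iterate A k i.
Proof.
move=> m2 A0 Ad; elim: k i => [|k IH] i //=.
by apply: powR_gt0; apply: homog_form_gt0 => // j; apply: ltW.
Qed.

Lemma power_iterateX (R : realType) (m n : nat) (A : tensor R m n)
    (k : nat) (i : 'I_n) :
  (2 <= m)%N -> tensor_nonneg A -> (forall i, 0 < A i (nseq_tuple m.-1 i)) ->
  power_iterate A k.+1 i ^+ m.-1 = homog_form A (power_iterate A k) i.
Proof.
move=> m2 A0 Ad; rewrite /= -powR_mulrn ?powR_ge0// -powRrM mulVf ?powRr1 //.
  by apply: homog_form_ge0 => // j; apply/ltW/power_iterate_gt0.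
by rewrite pnatr_eq0; case: (m) m2 => [|[]].
Qed.

(** The rescalings telescope: after [k] steps the tensor is the original one
    conjugated by the diagonal of the power iterate, hence its row sums are the
    Collatz-Wielandt ratios of that iterate. *)
Lemma tensor_iterE (R : realType) (m n : nat) (A : tensor R m n) (k : nat) :
  (2 <= m)%N -> tensor_nonneg A -> (forall i, 0 < A i (nseq_tuple m.-1 i)) ->
  (forall i t, tensor_iter A k i t =
     A i t * (\prod_(j <- t) power_iterate A k j) / power_iterate A k i ^+ m.-1) /\
  (forall i, tensor_rowsum (tensor_iter A k) i =
     homog_form A (power_iterate A k) i / power_iterate A k i ^+ m.-1).
Proof.
move=> m2 A0 Ad; set x := power_iterate A.
have x0 q i : 0 < x q i by apply: power_iterate_gt0.
have xX q i : x q.+1 i ^+ m.-1 = homog_form A (x q) i by apply: power_iterateX.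
have sumE q : (forall i t, tensor_iter A q i t =
     A i t * (\prod_(j <- t) x q j) / x q i ^+ m.-1) ->
    forall i, tensor_rowsum (tensor_iter A q) i = homog_form A (x q) i / x q i ^+ m.-1.
  move=> E i; rewrite /tensor_rowsum /homog_form mulr_suml.
  by apply: eq_bigr => t _; rewrite E.
suff E : forall i t, tensor_iter A k i t =
    A i t * (\prod_(j <- t) x k j) / x k i ^+ m.-1 by split=> //; apply: sumE.
elim: k => [|k IH] i t.
  by rewrite /x /= big1_eq expr1n divr1 mulr1.
have p0 : m.-1%:R != 0 :> R by rewrite pnatr_eq0; case: (m) m2 => [|[]].
have rootE j : tensor_rowsum (tensor_iter A k) j `^ m.-1%:R^-1 = x k.+1 j / x k j.
  rewrite sumE // -xX -exprVn -exprMn -powR_mulrn; last first.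
    by apply: mulr_ge0; rewrite ?invr_ge0 ltW.
  by rewrite -powRrM mulfV // powRr1 // mulr_ge0 ?invr_ge0 ?ltW.
have -> : tensor_iter A k.+1 = tensor_rescale (tensor_iter A k) by [].
rewrite /tensor_rescale (eq_bigr _ (fun j _ => rootE j)) big_split /=.
rewrite sumE // IH xX invfM invrK.
have Pn0 : \prod_(j <- t) x k j != 0.
  by apply: lt0r_neq0; apply: prodr_gt0.
rewrite prodfV.
have xn0 : x k i ^+ m.-1 != 0 by rewrite expf_neq0 ?lt0r_neq0.
have hn0 : homog_form A (x k) i != 0 by rewrite -xX expf_neq0 ?lt0r_neq0.
field.
by rewrite Pn0 hn0 xn0.
Qed.

(** * Positive eigenvectors and the spectral radius *)

Lemma normC_normc (R : realType) (z : R[i]%C) :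
  `|z| = (Normc.normc z)%:C%C.
Proof. by case: z => a b; rewrite normc_def. Qed.

Lemma normc_ge0 (R : realType) (z : R[i]%C) : 0 <= Normc.normc z.
Proof. by case: z => a b; apply: sqrtr_ge0. Qed.

(** A positive eigenvector [y] controls every complex eigenvector [z]: at an index
    where the quotient of [`|z i|] by [y i] is largest, the triangle inequality
    compares the row of [z] with a multiple of the row of [y]. *)
Lemma spectral_radius_pos_eigenvector (R : realType) (m n : nat)
    (A : tensor R m n.+1) (y : 'I_n.+1 -> R) (L : R) :
  tensor_nonneg A -> (forall i, 0 < y i) ->
  (forall i, homog_form A y i = L * y i ^+ m.-1) ->
  is_spectral_radius A L.
Proof.
move=> A0 y0 yE.
have L0 : 0 <= L.
  rewrite -(pmulr_lge0 _ (exprn_gt0 m.-1 (y0 ord0))) -yE.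
  by apply: homog_form_ge0 => // j; apply: ltW.
split.
  exists (L%:C)%C; last first.
    by rewrite normc_def /= expr0n addr0 sqrtr_sqr ger0_norm.
  exists (\col_i (y i)%:C%C); split.
    apply/eqP => /matrixP /(_ ord0 ord0); rewrite !mxE => -[e].
    by have := y0 ord0; rewrite e ltxx.
  apply/matrixP => i j; rewrite !mxE.
  transitivity ((homog_form A y i)%:C%C).
    rewrite /homog_form rmorph_sum; apply: eq_bigr => t _.
    rewrite rmorphM rmorph_prod /=; congr (_ * _).
    by apply: eq_bigr => k _; rewrite mxE.
  by rewrite yE rmorphM rmorphXn.
move=> lambda [x [xn0 xE]].
pose v i : R := Normc.normc (x i 0).
have v0 i : 0 <= v i by apply: normc_ge0.
have key i : Normc.normc lambda * v i ^+ m.-1 <= homog_form A v i.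
  rewrite -lecR rmorphM rmorphXn /= -!normC_normc -normrX -normrM.
  have := congr1 (fun M : 'cV_n.+1 => M i 0) xE; rewrite !mxE => <-.
  apply: le_trans (ler_norm_sum _ _ _) _.
  rewrite /homog_form rmorph_sum /=; apply: ler_sum => t _.
  rewrite normrM normr_prod rmorphM rmorph_prod /=.
  under [X in _ * X]eq_bigr do rewrite normC_normc.
  by rewrite /tensor_complex ger0_norm ?lecR.
rewrite normC_normc lecR.
have [i _ imax] := @arg_maxP _ _ _ (@ord0 n) xpredT (fun i => v i / y i) isT.
have vj j : v j <= v i / y i * y j by rewrite -ler_pdivrMr //; apply: imax.
have vi : 0 < v i.
  rewrite lt_def v0 andbT; apply/eqP => vi0; move/eqP: xn0; apply.
  apply/matrixP => j k; rewrite ord1 mxE; apply: Normc.eq0_normc.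
  by apply: le_anti; rewrite -/(v j) v0 andbT; have := vj j; rewrite vi0 !mul0r.
rewrite -(ler_pM2r (exprn_gt0 m.-1 vi)).
apply: le_trans (key i) _.
apply: (@le_trans _ _ (homog_form A (fun j => v i / y i * y j) i)).
  by apply: homog_form_le => // j; rewrite v0 vj.
rewrite homog_form_scale yE exprMn exprVn mulrCA -mulrA mulVf ?mulr1 //.
by rewrite expf_neq0 ?lt0r_neq0.
Qed.

(** * Limits along a filter *)

Lemma cvg_sumr {R : realType} {T : Type} {F : set_system T} {FF : Filter F}
    {I : Type} (s : seq I) (f : I -> T -> R) (l : I -> R) :
  (forall i, f i @ F --> l i) ->
  (fun k => \sum_(i <- s) f i k) @ F --> \sum_(i <- s) l i.
Proof.
move=> fl; elim: s => [|i s IH].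
  rewrite big_nil (_ : (fun k => _) = cst 0); first exact: cvg_cst.
  by apply/funext => k; rewrite big_nil.
rewrite big_cons (_ : (fun k => _) = (fun k => f i k + \sum_(j <- s) f j k)).
  exact: cvgD.
by apply/funext => k; rewrite big_cons.
Qed.

Lemma cvg_prodr {R : realType} {T : Type} {F : set_system T} {FF : Filter F}
    {I : Type} (s : seq I) (f : I -> T -> R) (l : I -> R) :
  (forall i, f i @ F --> l i) ->
  (fun k => \prod_(i <- s) f i k) @ F --> \prod_(i <- s) l i.
Proof.
move=> fl; elim: s => [|i s IH].
  rewrite big_nil (_ : (fun k => _) = cst 1); first exact: cvg_cst.
  by apply/funext => k; rewrite big_nil.
rewrite big_cons (_ : (fun k => _) = (fun k => f i k * \prod_(j <- s) f j k)).
  exact: cvgM.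
by apply/funext => k; rewrite big_cons.
Qed.

Lemma cvg_exprn {R : realType} {T : Type} {F : set_system T} {FF : Filter F}
    (p : nat) (f : T -> R) (l : R) :
  f @ F --> l -> (fun k => f k ^+ p) @ F --> l ^+ p.
Proof.
move=> fl; have := @cvg_prodr _ _ F _ _ (nseq p tt) (fun=> f) (fun=> l) (fun=> fl).
rewrite big_nseq iter_mulr_1.
rewrite (_ : (fun k => \prod_(i <- _) f k) = (fun k => f k ^+ p)) => [/(_ FF)//|].
by apply/funext => k; rewrite big_nseq iter_mulr_1.
Qed.

Lemma cvg_homog_form {R : realType} {m n : nat} (A : tensor R m n)
    {T : Type} {F : set_system T} {FF : Filter F}
    (z : T -> 'I_n -> R) (y : 'I_n -> R) (i : 'I_n) :
  (forall j, (fun k => z k j) @ F --> y j) ->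
  (fun k => homog_form A (z k) i) @ F --> homog_form A y i.
Proof.
move=> zy; rewrite /homog_form.
apply: (cvg_sumr _ (fun t k => A i t * \prod_(j <- t) z k j)) => t.
apply: cvgM; first exact: cvg_cst.
exact: (cvg_prodr _ (fun j k => z k j)).
Qed.

Lemma eq_limits {R : realType} {T : Type} {F : set_system T} {FF : ProperFilter F}
    {f g : T -> R} {a b : R} :
  (forall k, f k = g k) -> f @ F --> a -> g @ F --> b -> a = b.
Proof. by move=> /funext -> ga gb; apply: (cvg_unique _ ga gb). Qed.

(** Compactness of a segment gives a cluster point, and an ultrafilter converges to
    each of its cluster points. *)
Lemma ultra_bounded_cvg {R : realType} {T : Type} {U : set_system T}
    {UU : UltraFilter U} (f : T -> R) (a b : R) :
  (forall k, a <= f k <= b) -> exists l : R, f @ U --> l.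
Proof.
move=> fab; have [l [_ lcl]] : exists l : R, (`[a, b] `&` @cluster R (f @ U)) l.
  apply: segment_compact; apply: nearW => k.
  by rewrite /= in_itv /= fab.
exists l => V Vl; have [//|nV] := in_ultra_setVsetC (f @^-1` V) UU.
by have [w [nVw Vw]] := lcl (~` V) V nV Vl.
Qed.

(** * Extreme row sums *)

Lemma max_rowsum_ge (R : realType) (m n : nat) (A : tensor R m n.+1) (i : 'I_n.+1) :
  tensor_rowsum A i <= max_rowsum A.
Proof. exact: le_bigmax. Qed.

Lemma min_rowsum_le (R : realType) (m n : nat) (A : tensor R m n.+1) (i : 'I_n.+1) :
  min_rowsum A <= tensor_rowsum A i.
Proof. exact: bigmin_le. Qed.

Lemma max_rowsum_attained (R : realType) (m n : nat) (A : tensor R m n.+1) :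
  exists i, tensor_rowsum A i = max_rowsum A.
Proof.
rewrite /max_rowsum.
apply: (big_ind (fun v => exists i, tensor_rowsum A i = v)) =>
  [|a b [i <-] [j <-]|i _].
- by exists ord0.
- by rewrite /Order.max; case: ifP; [exists j | exists i].
- by exists i.
Qed.

Lemma min_rowsum_attained (R : realType) (m n : nat) (A : tensor R m n.+1) :
  exists i, tensor_rowsum A i = min_rowsum A.
Proof.
rewrite /min_rowsum.
apply: (big_ind (fun v => exists i, tensor_rowsum A i = v)) =>
  [|a b [i <-] [j <-]|i _].
- by exists ord0.
- by rewrite /Order.min; case: ifP; [exists i | exists j].
- by exists i.
Qed.

(** * The limit orbit *)

(** The limit orbit is built from an ultrafilter on the iteration numbers: along
    it every bounded sequence converges, so all the normalised iterates
    [power_iterate A (k + q)], for all [q] at once, have limits [Y q] without any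
    extraction of subsequences. The division is by the same sum for every [q], so
    that the recursion passes to the limit. Since the bounds [hi] converge, all
    the [Y q] have the same largest ratio [L], so [persistent_max_ratio] makes
    [Y 0] an eigenvector; as the ratio [l] is attained by [Y 0] too, [l = L]. *)
Lemma limit_orbit (R : realType) (m n : nat) (A : tensor R m n.+1)
    (lo hi : nat -> R) (l L : R) :
  (2 <= m)%N -> tensor_nonneg A -> tensor_irreducible A ->
  (forall i, 0 < A i (nseq_tuple m.-1 i)) ->
  let x := power_iterate A in
  (forall k i, homog_form A (x k) i <= hi k * x k i ^+ m.-1) ->
  (forall k, exists i, homog_form A (x k) i = lo k * x k i ^+ m.-1) ->
  (forall k, exists i, homog_form A (x k) i = hi k * x k i ^+ m.-1) ->
  (forall k, hi k <= hi 0%N) -> lo @ \oo --> l -> hi @ \oo --> L ->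
  l = L /\ exists2 y : 'I_n.+1 -> R, (forall i, 0 < y i) &
    forall i, homog_form A y i = L * y i ^+ m.-1.
Proof.
move=> m2 A0 Airr Ad x xhi xloE xhiE hi0 lol hiL.
have p0 : (0 < m.-1)%N by case: (m) m2 => [|[]].
have x0 k i : 0 < x k i by apply: power_iterate_gt0.
have xX k i : x k.+1 i ^+ m.-1 = homog_form A (x k) i by apply: power_iterateX.
have [U [UU Uoo]] := ultraFilterLemma (@eventually_filter).
pose s k := \sum_i x k i.
have s0 k : 0 < s k.
  rewrite /s big_ord_recl; apply: ltr_pwDl; first exact: x0.
  by apply: sumr_ge0 => i _; apply/ltW.
pose z q k i := (s k)^-1 * x (k + q)%N i.
have z0 q k i : 0 < z q k i by rewrite mulr_gt0 ?invr_gt0.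
have z0' q k i : 0 <= z q k i by apply/ltW.
have zX q k i : z q.+1 k i ^+ m.-1 = homog_form A (z q k) i.
  by rewrite homog_form_scale exprMn addnS xX.
have zhi q k i : homog_form A (z q k) i <= hi (k + q)%N * z q k i ^+ m.-1.
  by rewrite homog_form_scale exprMn mulrCA ler_pM2l ?xhi// exprn_gt0 ?invr_gt0.
(* That some row attains the bound is recorded as the vanishing of a product:
   the index of that row depends on [k], whereas the product passes to the limit. *)
have zloE q k : \prod_i (homog_form A (z q k) i - lo (k + q)%N * z q k i ^+ m.-1) = 0.
  have [i e] := xloE (k + q)%N; apply/eqP/prodf_eq0; exists i => //.
  by rewrite homog_form_scale exprMn mulrCA e subrr.
have zhiE q k : \prod_i (homog_form A (z q k) i - hi (k + q)%N * z q k i ^+ m.-1) = 0.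
  have [i e] := xhiE (k + q)%N; apply/eqP/prodf_eq0; exists i => //.
  by rewrite homog_form_scale exprMn mulrCA e subrr.
have hi00 : 0 < hi 0%N.
  have [i e] := xhiE 0%N.
  by rewrite -(pmulr_lgt0 _ (exprn_gt0 m.-1 (x0 0%N i))) -e -xX exprn_gt0.
have [c c0 cE] := root_gt0 p0 hi00.
(* Each step multiplies the iterate by at most [c], as [hi] is largest at 0. *)
have zb q k i : 0 <= z q k i <= c ^+ q.
  rewrite z0' /=; elim: q i => [|q IH] i.
    rewrite /z addn0 mulrC ler_pdivrMr // mul1r /s (bigD1 i) //= lerDl.
    by apply: sumr_ge0 => j _; apply/ltW.
  have cz0 : 0 <= c * z q k i by apply: mulr_ge0; rewrite ?ltW.
  have cz : z q.+1 k i <= c * z q k i.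
    rewrite -(ler_pXn2r p0) ?nnegrE//.
    rewrite zX exprMn cE; apply: le_trans (zhi _ _ _) _.
    by apply: ler_wpM2r => //; rewrite exprn_ge0.
  by apply: (le_trans cz); rewrite exprS ler_pM2l.
have zcvg q i : exists w : R, (fun k => z q k i) @ U --> w.
  exact: (ultra_bounded_cvg _ _ _ (fun k => zb q k i)).
pose Y q i := sval (cid (zcvg q i)).
have zY q i : (fun k => z q k i) @ U --> Y q i by rewrite /Y; case: cid.
have fY q i : (fun k => homog_form A (z q k) i) @ U --> homog_form A (Y q) i.
  by apply: cvg_homog_form => j; apply: zY.
have shiftU (u : nat -> R) (a : R) q : u @ \oo --> a -> (fun k => u (k + q)%N) @ U --> a.
  by rewrite -(cvg_shiftn q) => h V /h; apply: Uoo.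
have pY (u : nat -> R) (a : R) q i : u @ \oo --> a ->
    (fun k => u (k + q)%N * z q k i ^+ m.-1) @ U --> a * Y q i ^+ m.-1.
  by move=> ua; apply: cvgM; [apply: shiftU | apply: cvg_exprn].
have Y0 q i : 0 <= Y q i.
  by apply: (cvgr_to_ge (zY q i)); apply: nearW => k; apply/ltW.
have YX q i : Y q.+1 i ^+ m.-1 = homog_form A (Y q) i.
  exact: (eq_limits (zX q ^~ i) (cvg_exprn _ _ _ (zY q.+1 i)) (fY q i)).
have Yhi q i : homog_form A (Y q) i <= L * Y q i ^+ m.-1.
  by apply: (ler_cvg_to (fY q i) (pY _ _ q i hiL)); apply: nearW => k.
have attained (u : nat -> R) (a : R) q : u @ \oo --> a ->
    (forall k, \prod_i (homog_form A (z q k) i - u (k + q)%N * z q k i ^+ m.-1) = 0) ->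
    exists i, homog_form A (Y q) i = a * Y q i ^+ m.-1.
  move=> ua uz.
  have : \prod_i (homog_form A (Y q) i - a * Y q i ^+ m.-1) = 0.
    have h i : (fun k => homog_form A (z q k) i - u (k + q)%N * z q k i ^+ m.-1) @ U
        --> homog_form A (Y q) i - a * Y q i ^+ m.-1.
      by apply: cvgB; [apply: fY | apply: pY].
    exact: (eq_limits uz (cvg_prodr _ _ _ h) (cvg_cst _)).
  by move/eqP/prodf_eq0 => [i _]; rewrite subr_eq0 => /eqP e; exists i.
(* The normalisation survives in the limit and keeps [Y 0] away from zero. *)
have Ysum : \sum_i Y 0%N i = 1.
  have zsum k : \sum_i z 0%N k i = 1.
    rewrite /z -mulr_sumr; under eq_bigr do rewrite addn0.
    by rewrite mulVf // gt_eqF.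
  exact: (eq_limits zsum (cvg_sumr _ _ _ (zY 0%N)) (cvg_cst _)).
have Ypos q i : 0 < Y q i.
  elim: q i => [|q IH] i.
    apply: (supersolution_gt0 _ _ _ _ _ _ m2 A0 Airr (Y0 0%N) _ (Yhi 0%N)).
    apply: contrapT => /forallNP Yz; move: Ysum; rewrite big1 => [/esym/eqP|j _].
      by rewrite oner_eq0.
    by apply/eqP/negPn/negP; apply: Yz.
  rewrite lt_def Y0 andbT; apply/eqP => e.
  have := YX q i; rewrite e expr0n gtn_eqF //= => /eqP; rewrite eq_sym gt_eqF //.
  by apply: homog_form_gt0.
have YL : forall i, homog_form A (Y 0%N) i = L * Y 0%N i ^+ m.-1.
  apply: persistent_max_ratio => // q.
  exact: (attained hi L q hiL (zhiE q)).
split; last by exists (Y 0%N).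
have [i e] := attained lo l 0%N lol (zloE 0%N).
move: e; rewrite YL => /mulIf <- //.
by rewrite expf_neq0 // gt_eqF.
Qed.

(** * Convergence of the extreme row sums *)

Theorem mainTheorem1 (R : realType) (m n : nat) (hm : (2 <= m)%N)
    (B : tensor R m n.+1) (B_ge0 : tensor_nonneg B)
    (B_irr : tensor_irreducible B) :
  let A := tensor_add B (@tensor_id R m n.+1) in
  exists rho : R,
    [/\ is_spectral_radius A rho,
        (fun k : nat => min_rowsum (tensor_iter A k)) @ \oo --> rho &
        (fun k : nat => max_rowsum (tensor_iter A k)) @ \oo --> rho].
Proof.
move=> A.
have A0 : tensor_nonneg A by move=> i t; rewrite addr_ge0 // ler0n.
have Ad i : 0 < A i (nseq_tuple m.-1 i).
  rewrite /A /tensor_add /tensor_id all_nseq /= eqxx orbT.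
  by apply: ltr_wpDl.
have Airr : tensor_irreducible A.
  move=> [I [I0 IT Iz]]; apply: B_irr; exists I; split=> // i t iI tI.
  apply: le_anti; rewrite B_ge0 andbT -(Iz i t iI tI) lerDl.
  exact: ler0n.
set lo := fun k => min_rowsum _; set hi := fun k => max_rowsum _.
pose x := power_iterate A.
have x0 k i : 0 < x k i by apply: power_iterate_gt0.
have x0' k i : 0 <= x k i by apply/ltW.
have xp k i : 0 < x k i ^+ m.-1 by rewrite exprn_gt0.
have xX k i : x k.+1 i ^+ m.-1 = homog_form A (x k) i by apply: power_iterateX.
have rowE k i : tensor_rowsum (tensor_iter A k) i =
    homog_form A (x k) i / x k i ^+ m.-1 by case: (tensor_iterE _ _ _ A k hm A0 Ad).
have xlo k i : lo k * x k i ^+ m.-1 <= homog_form A (x k) i.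
  by rewrite -ler_pdivlMr // -rowE min_rowsum_le.
have xhi k i : homog_form A (x k) i <= hi k * x k i ^+ m.-1.
  by rewrite -ler_pdivrMr // -rowE max_rowsum_ge.
have xloE k : exists i, homog_form A (x k) i = lo k * x k i ^+ m.-1.
  have [i e] := min_rowsum_attained _ _ _ (tensor_iter A k); exists i.
  by rewrite /lo -e rowE divfK ?gt_eqF.
have xhiE k : exists i, homog_form A (x k) i = hi k * x k i ^+ m.-1.
  have [i e] := max_rowsum_attained _ _ _ (tensor_iter A k); exists i.
  by rewrite /hi -e rowE divfK ?gt_eqF.
have lo_gt0 k : 0 < lo k.
  have [i e] := xloE k.
  by rewrite -(pmulr_lgt0 _ (xp k i)) -e -xX.
have lo_hi k : lo k <= hi k.
  by rewrite (le_trans (min_rowsum_le _ _ _ _ ord0)) // max_rowsum_ge.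
have hi_gt0 k : 0 < hi k by apply: lt_le_trans (lo_hi k).
have hi_dec : {homo hi : k q / (k <= q)%N >-> q <= k}.
  apply/nonincreasing_seqP => k; have [i e] := xhiE k.+1.
  rewrite -(ler_pM2r (xp k.+1 i)) -e.
  by apply: (supersolution_step _ _ _ _ (x k)).
have lo_inc : {homo lo : k q / (k <= q)%N >-> k <= q}.
  apply/nondecreasing_seqP => k; have [i e] := xloE k.+1.
  rewrite -(ler_pM2r (xp k.+1 i)) -e.
  by apply: (subsolution_step _ _ _ _ (x k)).
have /cvg_ex[L hiL] : cvgn hi.
  by apply: nonincreasing_is_cvgn => //; exists 0 => _ [k _ <-]; apply/ltW.
have /cvg_ex[l lol] : cvgn lo.
  apply: nondecreasing_is_cvgn => //; exists (hi 0%N) => _ [k _ <-].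
  by apply: le_trans (lo_hi k) _; apply: hi_dec.
have [lL [y y0 yE]] := limit_orbit _ _ _ A lo hi l L hm A0 Airr Ad xhi xloE xhiE
  (fun k => hi_dec _ _ (leq0n k)) lol hiL.
exists L; split=> //; last by rewrite -lL.
exact: (spectral_radius_pos_eigenvector _ _ _ _ _ _ A0 y0 yE).
Qed.
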